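(* Let $\mathbb{F}$ be an algebraically closed field of characteristic $p > 0$, let $L$ be a finite-dimensional Lie algebra over $\mathbb{F}$, and let $L_{(p)}$ be a $p$-envelope of $L$. Then $U(L_{(p)}) \simeq U(L)[u_1,\ldots,u_q]$, a polynomial extension of $U(L)$ in $q = \dim_{\mathbb{F}}(L_{(p)}/L)$ variables. In particular, the enveloping skewfield $K(L_{(p)})$ is isomorphic to a ring of rational functions over $K(L)$.
   Context: For a Lie algebra $G$, $U(G)$ is its enveloping algebra and $K(G) = \mathrm{Frac}\, U(G)$ is the division ring of fractions of $U(G)$ (the enveloping skewfield). If $L$ is embedded in a restricted Lie algebra $(G,[p])$, the $p$-envelope of $L$ in $G$, denoted $L_{(p)}$, is the smallest restricted Lie subalgebra of $G$ (Lie subalgebra closed under the $p$-mapping) containing $L$. ''A $p$-envelope of $L$'' always means the $p$-envelope of $L$ in some finite-dimensional restricted Lie algebra containing $L$. Polynomial extension means that the variables $u_1,\ldots,u_q$ are central, i.e. $U(L)[u_1,\ldots,u_q] = U(L) \otimes_{\mathbb{F}} \mathbb{F}[u_1,\ldots,u_q]$. A ring of rational functions over a division ring $D$ is the skewfield of fractions of a polynomial ring $D[u_1,\ldots,u_q]$ in central variables. *)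

(* Defs.v *)
From HB Require Import structures.
From mathcomp Require Import all_boot all_order all_algebra.
From mathcomp Require Import generic_quotient ring_quotient boolp.
From mathcomp Require finmap monalg mpoly.

Set Implicit Arguments.
Unset Strict Implicit.
Unset Printing Implicit Defensive.

Import GRing.Theory.
Local Open Scope ring_scope.
Local Open Scope quotient_scope.

HB.mixin Record Vector_isLie (F : fieldType) L of Vector F L := {
  lie : L -> L -> L;
  lie_linearl : forall (a : F) (x y z : L),
    lie (a *: x + y) z = a *: lie x z + lie y z;
  lie_linearr : forall (a : F) (x y z : L),
    lie z (a *: x + y) = a *: lie z x + lie z y;
  liexx : forall x : L, lie x x = 0;
  lie_jacobi : forall x y z : L,
    lie x (lie y z) + lie y (lie z x) + lie z (lie x y) = 0
}.

(* Finite-dimensional Lie algebras: [Vector F] entails finite dimension. *)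
#[short(type="lieType")]
HB.structure Definition Lie (F : fieldType) :=
  { L of Vector_isLie F L & Vector F L }.

Definition is_lie_hom (F : fieldType) (L M : lieType F) (f : L -> M) : Prop :=
  forall x y : L, f (lie x y) = lie (f x) (f y).

Section LieSubalgebra.
Variables (F : fieldType) (G : lieType F).

Record lieSubalg := LieSubalg {
  lsub_vspace :> {vspace G};
  lsub_closed : forall x y : G,
    x \in lsub_vspace -> y \in lsub_vspace -> lie x y \in lsub_vspace
}.

Variable H : lieSubalg.

Fact subvs_lie_subproof (x y : subvs_of H) :
  lie (vsval x) (vsval y) \in (H : {vspace G}).
Proof. by apply: lsub_closed; apply: subvsP. Qed.

Definition subvs_lie (x y : subvs_of H) : subvs_of H :=
  Subvs (subvs_lie_subproof x y).

Fact subvs_lie_linearl a x y z :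
  subvs_lie (a *: x + y) z = a *: subvs_lie x z + subvs_lie y z.
Proof. by apply: val_inj; rewrite /= lie_linearl. Qed.

Fact subvs_lie_linearr a x y z :
  subvs_lie z (a *: x + y) = a *: subvs_lie z x + subvs_lie z y.
Proof. by apply: val_inj; rewrite /= lie_linearr. Qed.

Fact subvs_liexx x : subvs_lie x x = 0.
Proof. by apply: val_inj; rewrite /= liexx. Qed.

Fact subvs_lie_jacobi x y z :
  subvs_lie x (subvs_lie y z) + subvs_lie y (subvs_lie z x)
    + subvs_lie z (subvs_lie x y) = 0.
Proof. by apply: val_inj; rewrite /= lie_jacobi. Qed.

HB.instance Definition _ := Vector_isLie.Build F (subvs_of H)
  subvs_lie_linearl subvs_lie_linearr subvs_liexx subvs_lie_jacobi.

End LieSubalgebra.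

Section Restricted.
Variables (F : fieldType) (p : nat) (G : lieType F).

(* [ad_coef x y n k] is the coefficient of t^k in (ad (t x + y))^n (x),
   computed in the Lie algebra F[t] (x) G. *)
Fixpoint ad_coef (x y : G) (n k : nat) : G :=
  if n is n'.+1 then
    (if k is k'.+1 then lie x (ad_coef x y n' k') else 0)
      + lie y (ad_coef x y n' k)
  else if k == 0%N then x else 0.

(* Jacobson's s_i: i s_i(x, y) is the coefficient of t^(i-1) in
   (ad (t x + y))^(p-1) (x), for 1 <= i <= p - 1. *)
Definition jacobson_s (i : nat) (x y : G) : G :=
  (i%:R : F)^-1 *: ad_coef x y p.-1 i.-1.

Record is_p_mapping (f : G -> G) : Prop := IsPMapping {
  p_mapping_ad : forall x y : G, lie (f x) y = iter p (lie x) y;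
  p_mapping_scale : forall (a : F) (x : G), f (a *: x) = a ^+ p *: f x;
  p_mapping_add : forall x y : G,
    f (x + y) = f x + f y + \sum_(1 <= i < p) jacobson_s i x y
}.

Definition p_closed (f : G -> G) (H : lieSubalg G) : Prop :=
  forall x : G, x \in (H : {vspace G}) -> f x \in (H : {vspace G}).

End Restricted.

(* The smallest restricted subalgebra of (G, f) containing iota(L). *)
Record is_p_envelope (F : fieldType) (L G : lieType F) (f : G -> G)
    (iota : 'Hom(L, G)) (H : lieSubalg G) : Prop := IsPEnvelope {
  p_envelope_closed : p_closed f H;
  p_envelope_sub : (limg iota <= H)%VS;
  p_envelope_min : forall H' : lieSubalg G,
    p_closed f H' -> (limg iota <= H')%VS -> (H <= H')%VS
}.

(* Quotients by proper two-sided ideals (ring_quotient only covers the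
   commutative case). *)
Record proper_ideal2 (F : fieldType) (T : algType F) := ProperIdeal2 {
  ideal2 :> T -> Prop;
  ideal2_0 : ideal2 0;
  ideal2_sub : forall u v, ideal2 u -> ideal2 v -> ideal2 (u - v);
  ideal2_mull : forall u v, ideal2 v -> ideal2 (u * v);
  ideal2_mulr : forall u v, ideal2 u -> ideal2 (u * v);
  ideal2_proper : ~ ideal2 1
}.

Section QuotientAlgebra.
Variables (F : fieldType) (T : algType F) (I : proper_ideal2 T).

Definition ideal2b (u : T) : bool := `[< I u >].

Fact ideal2b_zmod_closed : zmod_closed ideal2b.
Proof.
split=> [|u v /asboolP hu /asboolP hv]; apply/asboolP; first exact: ideal2_0.
exact: ideal2_sub.
Qed.
HB.instance Definition _ := GRing.isZmodClosed.Build T ideal2b ideal2b_zmod_closed.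

Definition ideal2_zmod : zmodClosed T := GRing.ZmodClosed.clone T ideal2b _.

Definition quot_alg : Type := Quotient.quot ideal2_zmod.
HB.instance Definition _ := GRing.Zmodule.on quot_alg.

Definition quot_pi (u : T) : quot_alg := \pi_(Quotient.quot ideal2_zmod) u.

Lemma quot_piP u v : I (u - v) <-> quot_pi u = quot_pi v.
Proof.
by split=> [/asboolP|/eqP] h; [apply/eqP|apply/asboolP]; move: h;
  rewrite -[`[< _ >]]/(u - v \in ideal2_zmod) Quotient.idealrBE.
Qed.

Lemma quot_pi_surj (a : quot_alg) : exists u, a = quot_pi u.
Proof. by exists (repr a); rewrite /quot_pi reprK. Qed.

Fact quot_piD : {morph quot_pi : u v / u + v}.
Proof. by move=> u v; rewrite /quot_pi raddfD. Qed.

Definition quot_one : quot_alg := quot_pi 1.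
Definition quot_mul : quot_alg -> quot_alg -> quot_alg :=
  locked (fun a b => quot_pi (repr a * repr b)).
Definition quot_scale : F -> quot_alg -> quot_alg :=
  locked (fun c a => quot_pi (c *: repr a)).

Fact quot_repr u : I (repr (quot_pi u) - u).
Proof. by apply/quot_piP; rewrite /quot_pi reprK. Qed.

Fact quot_piM u v : quot_mul (quot_pi u) (quot_pi v) = quot_pi (u * v).
Proof.
rewrite /quot_mul -lock; apply/quot_piP; set u' := repr _; set v' := repr _.
have -> : u' * v' - u * v = (u' - u) * v' - u * (v - v').
  by rewrite mulrBl mulrBr opprB addrA subrK.
apply: ideal2_sub; first exact/ideal2_mulr/quot_repr.
apply: ideal2_mull; rewrite -opprB -sub0r.
by apply: ideal2_sub; [exact: ideal2_0|exact: quot_repr].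
Qed.

Fact quot_piZ c u : quot_scale c (quot_pi u) = quot_pi (c *: u).
Proof.
rewrite /quot_scale -lock; apply/quot_piP; rewrite -scalerBr -[_ - u]mul1r scalerAl.
exact/ideal2_mull/quot_repr.
Qed.

Fact quot_mulA : associative quot_mul.
Proof.
move=> a b c; have [u ->] := quot_pi_surj a; have [v ->] := quot_pi_surj b.
by have [w ->] := quot_pi_surj c; rewrite !quot_piM mulrA.
Qed.

Fact quot_mul1l : left_id quot_one quot_mul.
Proof. by move=> a; have [u ->] := quot_pi_surj a; rewrite quot_piM mul1r. Qed.

Fact quot_mul1r : right_id quot_one quot_mul.
Proof. by move=> a; have [u ->] := quot_pi_surj a; rewrite quot_piM mulr1. Qed.

Fact quot_mulDl : left_distributive quot_mul +%R.
Proof.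
move=> a b c; have [u ->] := quot_pi_surj a; have [v ->] := quot_pi_surj b.
by have [w ->] := quot_pi_surj c; rewrite !(quot_piM, =^~ quot_piD) mulrDl.
Qed.

Fact quot_mulDr : right_distributive quot_mul +%R.
Proof.
move=> a b c; have [u ->] := quot_pi_surj a; have [v ->] := quot_pi_surj b.
by have [w ->] := quot_pi_surj c; rewrite !(quot_piM, =^~ quot_piD) mulrDr.
Qed.

Fact quot_oner_neq0 : quot_one != 0.
Proof.
apply/negP => /eqP h; apply: (ideal2_proper (p := I)).
by rewrite -[1]subr0; apply/quot_piP; rewrite -/quot_one h /quot_pi raddf0.
Qed.

HB.instance Definition _ := GRing.Zmodule_isNzRing.Build quot_alg
  quot_mulA quot_mul1l quot_mul1r quot_mulDl quot_mulDr quot_oner_neq0.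

Fact quot_scaleA c d a : quot_scale c (quot_scale d a) = quot_scale (c * d) a.
Proof. by have [u ->] := quot_pi_surj a; rewrite !quot_piZ scalerA. Qed.

Fact quot_scale1 : left_id 1 quot_scale.
Proof. by move=> a; have [u ->] := quot_pi_surj a; rewrite quot_piZ scale1r. Qed.

Fact quot_scaleDr : right_distributive quot_scale +%R.
Proof.
move=> c a b; have [u ->] := quot_pi_surj a; have [v ->] := quot_pi_surj b.
by rewrite !(quot_piZ, =^~ quot_piD) scalerDr.
Qed.

Fact quot_scaleDl a : {morph quot_scale^~ a : c d / c + d}.
Proof.
move=> c d; have [u ->] := quot_pi_surj a.
by rewrite !(quot_piZ, =^~ quot_piD) scalerDl.
Qed.

HB.instance Definition _ := GRing.Zmodule_isLmodule.Build F quot_alg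
  quot_scaleA quot_scale1 quot_scaleDr quot_scaleDl.

Fact quot_scaleAl c (a b : quot_alg) : c *: (a * b) = (c *: a) * b.
Proof.
have [u ->] := quot_pi_surj a; have [v ->] := quot_pi_surj b.
by rewrite /GRing.scale /GRing.mul /= !(quot_piM, quot_piZ) scalerAl.
Qed.
HB.instance Definition _ :=
  GRing.Lmodule_isLalgebra.Build F quot_alg quot_scaleAl.

Fact quot_scaleAr c (a b : quot_alg) : c *: (a * b) = a * (c *: b).
Proof.
have [u ->] := quot_pi_surj a; have [v ->] := quot_pi_surj b.
by rewrite /GRing.scale /GRing.mul /= !(quot_piM, quot_piZ) scalerAr.
Qed.
HB.instance Definition _ :=
  GRing.Lalgebra_isAlgebra.Build F quot_alg quot_scaleAr.

Fact quot_pi_is_linear : linear quot_pi.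
Proof. by move=> c u v; rewrite quot_piD -quot_piZ. Qed.
HB.instance Definition _ :=
  GRing.isLinear.Build F T quot_alg *:%R quot_pi quot_pi_is_linear.

Fact quot_pi_is_monoid_morphism : monoid_morphism quot_pi.
Proof. by split=> // u v; rewrite -quot_piM. Qed.
HB.instance Definition _ :=
  GRing.isMonoidMorphism.Build T quot_alg quot_pi quot_pi_is_monoid_morphism.

Lemma quot_lift (A : algType F) (f : {lrmorphism T -> A}) :
  (forall u, I u -> f u = 0) ->
  exists g : {lrmorphism quot_alg -> A}, forall u, g (quot_pi u) = f u.
Proof.
move=> f0; pose g0 (a : quot_alg) := f (repr a).
have g0E u : g0 (quot_pi u) = f u.
  by apply/eqP; rewrite -subr_eq0 -raddfB; apply/eqP/f0/quot_repr.
have g0_lin : linear g0.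
  move=> c a b; have [u ->] := quot_pi_surj a; have [v ->] := quot_pi_surj b.
  by rewrite -linearP !g0E linearP.
have g0_mul : monoid_morphism g0.
  split=> [|a b]; first by rewrite -(rmorph1 quot_pi) g0E rmorph1.
  have [u ->] := quot_pi_surj a; have [v ->] := quot_pi_surj b.
  by rewrite -rmorphM !g0E rmorphM.
pose l0 := GRing.isLinear.Build F quot_alg A *:%R g0 g0_lin.
pose m0 := GRing.isMonoidMorphism.Build quot_alg A g0 g0_mul.
pose g : {lrmorphism quot_alg -> A} := HB.pack g0 l0 m0.
by exists g.
Qed.

End QuotientAlgebra.

(* The free associative F-algebra on a set X, spanned by the words in X. *)
Section FreeAlgebra.
Import monalg.
Variables (F : fieldType) (X : choiceType).

Definition free_alg : Type := malg (fmonom X) F.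
HB.instance Definition _ := GRing.Lalgebra.on free_alg.

Fact free_scaleAr (c : F) (u v : free_alg) : c *: (u * v) = u * (c *: v).
Proof.
have cC : mkmalgU monalg.one c * u = u * mkmalgU monalg.one c.
  rewrite [u]monalgE mulr_sumr mulr_suml; apply: eq_bigr => k _.
  apply: (etrans (fgmulUU _ _ _ _)); apply: (etrans _ (esym (fgmulUU _ _ _ _))).
  by rewrite mul1m mulm1 mulrC.
apply: (etrans (esym (mul_malgC c _))); apply: (etrans (mulrA _ _ _)).
apply: (etrans (congr1 (fun w : free_alg => w * v) cC)).
apply: (etrans (esym (mulrA _ _ _))).
by congr (_ * _); apply: mul_malgC.
Qed.
HB.instance Definition _ :=
  GRing.Lalgebra_isAlgebra.Build F free_alg free_scaleAr.

Definition free_gen (x : X) : free_alg := mkmalgU (fmu x) 1.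

Lemma free_algE (u : free_alg) :
  u = \sum_(m <- finmap.enum_fset (monalg.msupp u))
        monalg.mcoeff m u *: \prod_(x <- fmonom_val m) free_gen x.
Proof.
apply: (etrans (monalgE u)); apply: eq_bigr => m _.
have -> : \prod_(x <- fmonom_val m) free_gen x = mkmalgU m 1.
  case: m => s /=; elim: s => [|x s IHs].
    rewrite big_nil; apply: (congr1 (fun m => mkmalgU m (1 : F))).
    by apply/eqP; rewrite fmP fm1.
  rewrite big_cons IHs; apply: (etrans (fgmulUU _ _ _ _)); rewrite mulr1.
  apply: (congr1 (fun m => mkmalgU m (1 : F))).
  by apply/eqP; rewrite fmP fmM fmU.
apply: (etrans _ (mul_malgC _ _)); apply: (etrans _ (esym (fgmulUU _ _ _ _))).
by rewrite mulr1 mul1m.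
Qed.

Lemma free_ext (A : algType F) (g h : {lrmorphism free_alg -> A}) :
  (forall x, g (free_gen x) = h (free_gen x)) -> g =1 h.
Proof.
move=> gh u; rewrite [u]free_algE !linear_sum; apply: eq_bigr => m _.
rewrite !linearZ !rmorph_prod; congr (_ *: _).
by apply: eq_bigr => x _; apply: gh.
Qed.

Section Lift.
Variables (A : algType F) (f : X -> A).

Definition free_word (m : fmonom X) : A := \prod_(x <- fmonom_val m) f x.

Fact free_word_mmorphism : mmorphism free_word.
Proof.
split=> [m1 m2|]; last by rewrite /free_word fm1 big_nil.
by rewrite /free_word fmM big_cat.
Qed.
HB.instance Definition _ :=
  monalg.isMultiplicative.Build (fmonom X) A free_word free_word_mmorphism.

Definition free_map : free_alg -> A := monalg.mmap (in_alg A) free_word.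

Fact free_map_linear : linear free_map.
Proof.
move=> a u v; rewrite /free_map raddfD; congr (_ + _).
apply: (etrans (monalg.mmapZ _ _)); exact: mulr_algl.
Qed.
HB.instance Definition _ :=
  GRing.isLinear.Build F free_alg A *:%R free_map free_map_linear.

Fact free_map_monoid_morphism : monoid_morphism free_map.
Proof.
have [hM h1] : multiplicative free_map.
  apply: monalg.commr_mmap_is_multiplicative => g m m'.
  by rewrite /GRing.comm mulr_algl mulr_algr.
by split.
Qed.
HB.instance Definition _ :=
  GRing.isMonoidMorphism.Build free_alg A free_map free_map_monoid_morphism.

Lemma free_map_gen x : free_map (free_gen x) = f x.
Proof.
by rewrite /free_map monalg.mmapU /= scale1r mul1r /free_word fmU big_seq1.
Qed.

End Lift.

End FreeAlgebra.

(* The two-sided ideal generated by the relations expressing that e is linear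
   and maps the bracket to the commutator. *)
Section EnvelopingRelations.
Variables (F : fieldType) (L : lieType F) (T : algType F) (e : L -> T).

Inductive uea_rel : T -> Prop :=
| UeaRel_lin (a : F) (x y : L) : uea_rel (e (a *: x + y) - (a *: e x + e y))
| UeaRel_lie (x y : L) : uea_rel (e (lie x y) - (e x * e y - e y * e x))
| UeaRel_0 : uea_rel 0
| UeaRel_sub (u v : T) : uea_rel u -> uea_rel v -> uea_rel (u - v)
| UeaRel_mull (u v : T) : uea_rel v -> uea_rel (u * v)
| UeaRel_mulr (u v : T) : uea_rel u -> uea_rel (u * v).

Fact uea_rel_map (A : algType F) (f : {linear L -> A})
    (g : {lrmorphism T -> A}) :
  (forall x, g (e x) = f x) ->
  (forall x y, f (lie x y) = f x * f y - f y * f x) ->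
  forall u, uea_rel u -> g u = 0.
Proof.
move=> gE f_lie u; elim=> [a x y|x y||v w _ hv _ hw|v w _ hw|v w _ hv].
- by rewrite linearB linearD linearZ /= !gE linearP subrr.
- by rewrite !rmorphB !rmorphM /= !gE f_lie subrr.
- exact: rmorph0.
- by rewrite rmorphB /= hv hw subrr.
- by rewrite rmorphM /= hw mulr0.
- by rewrite rmorphM /= hv mul0r.
Qed.

End EnvelopingRelations.

(* The enveloping algebra U(L) is presented as the quotient of the free
   associative F-algebra on the set L by the above ideal for e = free_gen; the
   linearity relations cut the free algebra down to the tensor algebra of L. *)
Section Enveloping.
Variables (F : fieldType) (L : lieType F).
Local Notation T := (free_alg F L).
Local Notation e := (@free_gen F L).

(* The augmentation extends the zero map L -> F. *)
Fact uea_rel_proper : ~ uea_rel e 1.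
Proof.
pose z : {linear L -> F^o} := GRing.Linear.clone F L F^o *:%R \0 _.
have z_lie x y : z (lie x y) = z x * z y - z y * z x by rewrite /= mulr0 subrr.
by move/(uea_rel_map (free_map_gen z) z_lie)/eqP; rewrite rmorph1 oner_eq0.
Qed.

Definition uea_ideal : proper_ideal2 T :=
  ProperIdeal2 (UeaRel_0 e) (@UeaRel_sub _ _ _ e) (@UeaRel_mull _ _ _ e)
    (@UeaRel_mulr _ _ _ e) uea_rel_proper.

Definition uea : Type := quot_alg uea_ideal.
HB.instance Definition _ := GRing.Algebra.on uea.

(* The canonical map L -> U(L). *)
Definition uea_in (x : L) : uea := quot_pi uea_ideal (e x).

Fact uea_in_linear : linear uea_in.
Proof.
move=> a x y; apply: (etrans _ (linearP (quot_pi uea_ideal) a (e x) (e y))).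
exact/quot_piP/UeaRel_lin.
Qed.
HB.instance Definition _ :=
  GRing.isLinear.Build F L uea *:%R uea_in uea_in_linear.

Lemma uea_in_lie x y :
  uea_in (lie x y) = uea_in x * uea_in y - uea_in y * uea_in x.
Proof.
apply: (@etrans _ _ (quot_pi uea_ideal (e x * e y - e y * e x))).
  exact/quot_piP/UeaRel_lie.
by rewrite raddfB; congr (_ - _); apply: rmorphM.
Qed.

Theorem uea_universal (A : algType F) (f : {linear L -> A}) :
  (forall x y, f (lie x y) = f x * f y - f y * f x) ->
  exists g : {lrmorphism uea -> A}, forall x, g (uea_in x) = f x.
Proof.
move=> f_lie.
have [g gE] := quot_lift (I := uea_ideal) (uea_rel_map (free_map_gen f) f_lie).
by exists g => x; rewrite gE; apply: free_map_gen.
Qed.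

Theorem uea_ext (A : algType F) (g h : {lrmorphism uea -> A}) :
  (forall x, g (uea_in x) = h (uea_in x)) -> g =1 h.
Proof.
move=> gh a; have [u ->] := quot_pi_surj a.
pose pi : {lrmorphism T -> uea} := quot_pi uea_ideal.
by apply: (@free_ext F L A (g \o pi) (h \o pi)) => x; apply: gh.
Qed.

End Enveloping.

(* A[u_1, ..., u_n] as an F-algebra, for an F-algebra A: the variables commute
   with each other and with A. This is an alias of {mpoly A[n]}, whose own
   scalars are in A. *)
Module CentralPolyAlgebra.
Section CentralPoly.
Import mpoly.
Variables (F : fieldType) (A : algType F) (n : nat).

Definition central_poly : Type := {mpoly A[n]}.
HB.instance Definition _ := GRing.NzRing.on central_poly.

Definition cpoly_scale (c : F) (P : central_poly) : central_poly :=
  (c%:A : A) *: (P : {mpoly A[n]}).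

Fact cpoly_scaleA c d P :
  cpoly_scale c (cpoly_scale d P) = cpoly_scale (c * d) P.
Proof. by rewrite /cpoly_scale scalerA -scalerAl mul1r scalerA. Qed.

Fact cpoly_scale1 : left_id 1 cpoly_scale.
Proof. by move=> P; rewrite /cpoly_scale !scale1r. Qed.

Fact cpoly_scaleDr : right_distributive cpoly_scale +%R.
Proof. by move=> c P Q; rewrite /cpoly_scale scalerDr. Qed.

Fact cpoly_scaleDl P : {morph cpoly_scale^~ P : c d / c + d}.
Proof. by move=> c d; rewrite /cpoly_scale !scalerDl. Qed.

HB.instance Definition _ := GRing.Zmodule_isLmodule.Build F central_poly
  cpoly_scaleA cpoly_scale1 cpoly_scaleDr cpoly_scaleDl.

Fact cpoly_scaleAl c (P Q : central_poly) : c *: (P * Q) = (c *: P) * Q.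
Proof. exact: (mpoly_scaleAl (c%:A : A) (P : {mpoly A[n]}) Q). Qed.
HB.instance Definition _ :=
  GRing.Lmodule_isLalgebra.Build F central_poly cpoly_scaleAl.

Fact cpoly_scaleAr c (P Q : central_poly) : c *: (P * Q) = P * (c *: Q).
Proof.
rewrite /GRing.scale /= /cpoly_scale.
apply/mpolyP => m; rewrite mcoeffZ !mcoeffM mulr_sumr; apply: eq_bigr => k _.
by rewrite mcoeffZ !mulr_algl scalerAr.
Qed.
HB.instance Definition _ :=
  GRing.Lalgebra_isAlgebra.Build F central_poly cpoly_scaleAr.

End CentralPoly.
End CentralPolyAlgebra.
Export CentralPolyAlgebra.

Definition alg_isom (F : fieldType) (A B : algType F) : Prop :=
  exists f : {lrmorphism A -> B}, bijective f.

(* [j] exhibits the F-algebra K as the (two-sided) division ring of fractions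
   of its subring j(R). *)
Record is_frac_skewfield (F : fieldType) (R : algType F) (K : unitAlgType F)
    (j : {lrmorphism R -> K}) : Prop := IsFracSkewfield {
  frac_division : forall z : K, z != 0 -> z \is a GRing.unit;
  frac_inj : injective j;
  frac_right : forall z : K, exists a s : R, s != 0 /\ z = j a / j s;
  frac_left : forall z : K, exists a s : R, s != 0 /\ z = (j s)^-1 * j a
}.

Definition is_rational_function_ring (F : fieldType) (D : unitAlgType F)
    (n : nat) (Q : unitAlgType F) : Prop :=
  exists k : {lrmorphism central_poly D n -> Q}, is_frac_skewfield k.

(* Main.v *)
(* Let E be the image of L and H its p-envelope. Minimality of H gives
   [H, H] <= E, hence every subspace between E and H is an ideal, and, again by
   minimality, there is a flag E = M_0 < ... < M_q = H with
   M_(k+1) = M_k + <w_k>, where w_k = y_k^[p] for some y_k in M_k. In U(H) the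
   element w_k - y_k^p is central, because ad (y^p) = (ad y)^p in
   characteristic p. So u_k |-> w_k - y_k^p defines a homomorphism from
   U(L)[u_0, ..., u_(q-1)] to U(H), with inverse determined recursively by
   w_k |-> (image of y_k)^p + u_k; no Poincare-Birkhoff-Witt theorem is needed.
   For the skewfields, U(L) -> K(H) extends to K(L) by the Ore property, and
   clearing denominators shows that K(H) is itself the skewfield of fractions
   of K(L)[u]. *)
Require Import Defs.
From HB Require Import structures.
From mathcomp Require Import all_boot all_order all_algebra.
From mathcomp Require Import boolp.
From mathcomp Require mpoly.

Set Implicit Arguments.
Unset Strict Implicit.
Unset Printing Implicit Defensive.

Import GRing.Theory.
Local Open Scope ring_scope.

(** * Polynomial algebras in central variables *)

Module CentralPolyTheory.
Section CentralPolyTheory.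
Import mpoly.
Variables (F : fieldType) (n : nat).

Definition cpolyC (A : algType F) (a : A) : central_poly A n := mpolyC n a.
Definition cpolyX (A : algType F) (i : 'I_n) : central_poly A n :=
  ('X_i : {mpoly A[n]}).

Fact cpolyC_linear (A : algType F) : linear (@cpolyC A).
Proof.
move=> c a b; apply/mpolyP => m.
rewrite /cpolyC /GRing.scale /= /cpoly_scale.
by rewrite mcoeffD mcoeffZ !mcoeffC mulrDl mulr_algl scalerAl.
Qed.
HB.instance Definition _ (A : algType F) :=
  GRing.isLinear.Build F A (central_poly A n) *:%R (@cpolyC A)
    (@cpolyC_linear A).

Fact cpolyC_monoid_morphism (A : algType F) : monoid_morphism (@cpolyC A).
Proof. by split=> // a b; apply: (mpolyCM n a b). Qed.
HB.instance Definition _ (A : algType F) :=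
  GRing.isMonoidMorphism.Build A (central_poly A n) (@cpolyC A)
    (@cpolyC_monoid_morphism A).

Lemma cpolyC_inj (A : algType F) : injective (@cpolyC A).
Proof. exact: can_inj (@mpolyCK n A). Qed.

Lemma commr_cpolyX (A : algType F) (P : central_poly A n) i :
  GRing.comm P (cpolyX A i).
Proof. exact: commr_mpolyX. Qed.

Lemma cpoly_ind (A : algType F) (P : central_poly A n -> Prop) :
  P 0 ->
  (forall c m p, P p -> P (cpolyC c * \prod_(i < n) cpolyX A i ^+ m i + p)) ->
  forall p, P p.
Proof.
move=> P0 PD; elim/mpolyind => [//|c m p _ _ Pp].
rewrite -mul_mpolyC mpolyXE_id; exact: (PD c m p Pp).
Qed.

(** Evaluation at [z] is always additive. It is multiplicative because the [z i] are central in [B],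
    so monomials in them move past the images of coefficients. *)
Lemma cpoly_universal (A B : algType F) (g : {lrmorphism A -> B})
    (z : 'I_n -> B) :
  (forall i b, GRing.comm b (z i)) ->
  exists k : {lrmorphism central_poly A n -> B},
    (forall a, k (cpolyC a) = g a) /\ (forall i, k (cpolyX A i) = z i).
Proof.
move=> z_comm; pose k0 : central_poly A n -> B := mmap g z.
have k0C a : k0 (cpolyC a) = g a by apply: mmapC.
have k0X i : k0 (cpolyX A i) = z i by rewrite /k0 mmapX mmap1U.
have k0_lin : linear k0.
  move=> c P Q; rewrite /k0 mmapD; congr (_ + _).
  by rewrite -[RHS]mulr_algl -(rmorph_alg g); apply: (mmapZ z g c%:A P).
have k0_mul : monoid_morphism k0.
  have [kM k1] : multiplicative k0.
    apply: commr_mmap_is_multiplicative => [//|P m m'].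
    rewrite /mmap1; apply: big_rec => [|i x _ hx]; first exact: commr1.
    exact/commrM/hx/commrX/z_comm.
  by split.
pose l0 := GRing.isLinear.Build F (central_poly A n) B *:%R k0 k0_lin.
pose m0 := GRing.isMonoidMorphism.Build (central_poly A n) B k0 k0_mul.
pose k : {lrmorphism central_poly A n -> B} := HB.pack k0 l0 m0.
by exists k.
Qed.

Lemma cpoly_ext (A B : algType F) (g h : {lrmorphism central_poly A n -> B}) :
  (forall a, g (cpolyC a) = h (cpolyC a)) ->
  (forall i, g (cpolyX A i) = h (cpolyX A i)) -> g =1 h.
Proof.
move=> ghC ghX; elim/cpoly_ind => [|c m p IHp]; first by rewrite !rmorph0.
rewrite !rmorphD !rmorphM /= IHp ghC !rmorph_prod; congr (_ * _ + _).
by apply: eq_bigr => i _; rewrite !rmorphXn /= ghX.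
Qed.

End CentralPolyTheory.
End CentralPolyTheory.
Import CentralPolyTheory.

(** * Skewfields of fractions and the Ore condition *)

Section OreFractions.
Variables (F : fieldType) (R : algType F) (K : unitAlgType F).
Variables (j : {lrmorphism R -> K}) (jK : is_frac_skewfield j).

Lemma frac_neq0_unit (a : R) : a != 0 -> j a \is a GRing.unit.
Proof.
move=> a0; apply: (frac_division jK).
by rewrite -(rmorph0 j) (inj_eq (frac_inj jK)).
Qed.

Lemma frac_mul_neq0 (a b : R) : a != 0 -> b != 0 -> a * b != 0.
Proof.
move=> a0 b0; apply/eqP => ab0.
have : j (a * b) \is a GRing.unit by rewrite rmorphM unitrMl ?frac_neq0_unit.
by rewrite ab0 rmorph0 unitr0.
Qed.

Lemma frac_rightP (z : K) : exists a s : R, s != 0 /\ z * j s = j a.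
Proof.
have [a [s [s0 ->]]] := frac_right jK z; exists a, s; split=> //.
by rewrite divrK ?frac_neq0_unit.
Qed.

Lemma frac_leftP (z : K) : exists a s : R, s != 0 /\ j s * z = j a.
Proof.
have [a [s [s0 ->]]] := frac_left jK z; exists a, s; split=> //.
by rewrite mulVKr ?frac_neq0_unit.
Qed.

(** The left fraction s^-1 b is also a right fraction c d^-1; clearing both denominators gives the
    right Ore condition. *)
Lemma frac_ore (b s : R) : s != 0 -> exists c d : R, d != 0 /\ b * d = s * c.
Proof.
move=> s0; have [c [d [d0 zE]]] := frac_rightP ((j s)^-1 * j b).
exists c, d; split=> //; apply: (frac_inj jK).
by rewrite !rmorphM /= -zE !mulrA divrr ?mul1r ?frac_neq0_unit.
Qed.

(** The fraction a s^-1 must go to g(a) g(s)^-1, which makes sense because injectivity of [g] turns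
    nonzero denominators into units. The Ore condition shows that the value does not depend on the
    fraction chosen, and provides the denominators for sums and products. *)
Lemma frac_extend (D : unitAlgType F) (g : {lrmorphism R -> D}) :
  (forall z : D, z != 0 -> z \is a GRing.unit) -> injective g ->
  exists h : {lrmorphism K -> D}, forall a, h (j a) = g a.
Proof.
move=> divD g_inj.
have gU (a : R) : a != 0 -> g a \is a GRing.unit.
  by move=> a0; apply: divD; rewrite -(rmorph0 g) (inj_eq g_inj).
have /choice[num /choice[den numden]] := frac_rightP.
pose h0 z := g (num z) / g (den z).
(* Independence of the representation: [a / s] and the chosen [b / t] are compared over the common
   right multiple s d = t c. *)
have h0P z a s : z * j s = j a -> h0 z * g s = g a.
  move=> zs; have [t0 zt] := numden z; rewrite /h0.
  set b := num z in zt *; set t := den z in t0 zt *.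
  have [c [d [d0 sd]]] := frac_ore s t0.
  have ad : a * d = b * c.
    apply: (frac_inj jK); rewrite !rmorphM /= -zs -zt -!mulrA.
    by rewrite -!(rmorphM j) sd.
  apply: (mulIr (gU d d0)); rewrite -[LHS]mulrA -!(rmorphM g) sd ad !rmorphM /=.
  by rewrite mulrA divrK ?gU.
have h0_eq z a s v : s != 0 -> z * j s = j a -> v * g s = g a -> h0 z = v.
  by move=> s0 /h0P <- vs; apply: (mulIr (gU s s0)).
have h0j a : h0 (j a) = g a.
  by apply: (@h0_eq _ a 1); rewrite ?oner_neq0 // rmorph1 mulr1.
have h0_lin : linear h0.
  move=> c z1 z2; have [a1 [s1 [s10 z1E]]] := frac_rightP z1.
  have [a2 [s2 [s20 z2E]]] := frac_rightP z2.
  (* The common denominator of both summands is s1 c1 = s2 c2. *)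
  have [c2 [c1 [c10 m12]]] := frac_ore s1 s20.
  have m0 : s1 * c1 != 0 by apply: frac_mul_neq0.
  have h1 : z1 * j (s1 * c1) = j (a1 * c1) by rewrite !rmorphM mulrA z1E.
  have h2 : z2 * j (s1 * c1) = j (a2 * c2) by rewrite m12 !rmorphM mulrA z2E.
  apply: (h0_eq _ (c *: (a1 * c1) + a2 * c2) _ _ m0).
    by rewrite mulrDl -scalerAl h1 h2 linearP.
  by rewrite mulrDl -scalerAl (h0P _ _ _ h1) (h0P _ _ _ h2) linearP.
have h0_mul : monoid_morphism h0.
  split=> [|z1 z2]; first by rewrite -(rmorph1 j) h0j rmorph1.
  have [a1 [s1 [s10 z1E]]] := frac_rightP z1.
  have [a2 [s2 [s20 z2E]]] := frac_rightP z2.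
  (* Since s1^-1 a2 = c d^-1, the product z1 z2 is the fraction (a1 c)(s2 d)^-1. *)
  have [c [d [d0 a2d]]] := frac_ore a2 s10.
  have m0 : s2 * d != 0 by apply: frac_mul_neq0.
  have h2 : z2 * j (s2 * d) = j (a2 * d) by rewrite !rmorphM mulrA z2E.
  apply: (h0_eq _ (a1 * c) _ _ m0).
    by rewrite -mulrA h2 a2d !rmorphM /= mulrA z1E.
  by rewrite -mulrA (h0P _ _ _ h2) a2d !rmorphM /= mulrA (h0P _ _ _ z1E).
pose l0 := GRing.isLinear.Build F K D *:%R h0 h0_lin.
pose m0 := GRing.isMonoidMorphism.Build K D h0 h0_mul.
pose h : {lrmorphism K -> D} := HB.pack h0 l0 m0.
by exists h.
Qed.

(** Denominators are collected on the left, one term at a time: if [s] clears the terms treated so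
    far and [t] clears s c, then t s clears the terms including c. *)
Lemma cpoly_common_denominator n
    (mj : {lrmorphism central_poly R n -> central_poly K n}) :
  (forall a, mj (cpolyC n a) = cpolyC n (j a)) ->
  (forall i, mj (cpolyX R i) = cpolyX K i) ->
  forall P, exists s P', s != 0 /\ cpolyC n (j s) * P = mj P'.
Proof.
move=> mjC mjX; elim/cpoly_ind => [|c m P [s [P' [s0 sP]]]].
  by exists 1, 0; rewrite oner_neq0 mulr0 rmorph0.
have [a [t [t0 tE]]] := frac_leftP (j s * c).
exists (t * s).
exists (cpolyC n a * \prod_(i < n) cpolyX R i ^+ m i + cpolyC n t * P').
split; first exact: frac_mul_neq0.
rewrite mulrDr rmorphD !rmorphM /= -sP !mjC -tE !rmorphM /= !mulrA.
congr (_ * _ + _); rewrite rmorph_prod; apply: eq_bigr => i _.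
by rewrite rmorphXn /= mjX.
Qed.

End OreFractions.

(** The skewfield [KB] itself serves as the skewfield of fractions of [KA[u]]: it receives [KA] by
    extension from [A], and its elements are already fractions of elements of [B], hence of
    polynomials over [A]. *)
Lemma rational_functions_of_isom (F : fieldType) n (A B : algType F)
    (psi : {lrmorphism central_poly A n -> B}) (KB KA : unitAlgType F)
    (jB : {lrmorphism B -> KB}) (jA : {lrmorphism A -> KA}) :
  bijective psi -> is_frac_skewfield jB -> is_frac_skewfield jA ->
  is_rational_function_ring KA n KB.
Proof.
move=> psi_bij jBP jAP; have psi_inj := bij_inj psi_bij.
have [psiV _ psiVK] := psi_bij.
pose g : {lrmorphism A -> KB} := jB \o (psi \o cpolyC n (A := A)).
have g_inj : injective g.
  by move=> x y /= /(frac_inj jBP)/psi_inj/cpolyC_inj.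
have [h hE] := frac_extend jAP (frac_division jBP) g_inj.
pose z i := jB (psi (cpolyX A i)).
(* Surjectivity of [psi] makes the image of a variable central in [B]; commuting with numerators and
   denominators, it is then central in [KB]. *)
have z_comm i b : GRing.comm b (z i).
  have [a [s [s0 bE]]] := frac_rightP jBP b.
  have jcomm x : GRing.comm (jB x) (z i).
    rewrite /GRing.comm -!rmorphM; congr (jB _).
    by rewrite -(psiVK x) -!rmorphM commr_cpolyX.
  apply: (mulIr (frac_neq0_unit jBP s0)); rewrite -[RHS]mulrA bE.
  by rewrite -mulrA -jcomm mulrA bE jcomm.
have [k [kC kX]] := cpoly_universal h z_comm.
have [mj [mjC mjX]] := cpoly_universal (cpolyC n (A := KA) \o jA)
  (fun i b => commr_cpolyX b i).
have kmj P : k (mj P) = jB (psi P).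
  apply: (cpoly_ext (g := k \o mj) (h := jB \o psi)) => [a|i] /=.
    by rewrite mjC kC hE.
  by rewrite mjX kX.
exists k; split.
- exact: frac_division jBP.
(* Up to a unit, [P] comes from a polynomial over [A], on which [k] agrees with the injective map
   [jB \o psi]. *)
- apply: raddf_inj => P kP0.
  have [s [P' [s0 sP]]] := cpoly_common_denominator jAP mjC mjX P.
  have P'0 : P' = 0.
    apply/psi_inj/(frac_inj jBP); rewrite -kmj -sP rmorphM /= kP0 mulr0.
    by rewrite !rmorph0.
  have sU := frac_neq0_unit jAP s0.
  by rewrite -[P]mul1r -(rmorph1 (cpolyC n (A := KA))) -(mulVr sU) rmorphM /=
    -mulrA sP P'0 rmorph0 mulr0.
- move=> w; have [a [s [s0 ->]]] := frac_right jBP w.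
  exists (mj (psiV a)), (mj (psiV s)); rewrite !kmj !psiVK; split=> //.
  apply: contra_neq s0 => /(congr1 k); rewrite kmj psiVK rmorph0 -(rmorph0 jB).
  exact: frac_inj jBP _ _.
- move=> w; have [a [s [s0 ->]]] := frac_left jBP w.
  exists (mj (psiV a)), (mj (psiV s)); rewrite !kmj !psiVK; split=> //.
  apply: contra_neq s0 => /(congr1 k); rewrite kmj psiVK rmorph0 -(rmorph0 jB).
  exact: frac_inj jBP _ _.
Qed.

(** * Commutators with p-th powers in characteristic p *)

Section Commutators.
Variables (F : fieldType) (p : nat) (charFp : p \in [pchar F]).
Variables (A : algType F).

Let ad (a b : A) := a * b - b * a.

(** Left multiplication by [a] is the sum of [ad a] and right multiplication by [a]; these commute,
    so the binomial theorem applies. *)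
Lemma expr_mul_ad n (a b : A) :
  a ^+ n * b = \sum_(i < n.+1) (iter i (ad a) b * a ^+ (n - i)) *+ 'C(n, i).
Proof.
elim: n => [|n IHn]; first by rewrite big_ord1 /= mul1r mulr1.
rewrite exprS -mulrA IHn mulr_sumr.
have step (i : 'I_n.+1) :
    a * ((iter i (ad a) b * a ^+ (n - i)) *+ 'C(n, i)) =
    (iter i (ad a) b * a ^+ (n.+1 - i)) *+ 'C(n, i)
    + (iter i.+1 (ad a) b * a ^+ (n - i)) *+ 'C(n, i).
  rewrite mulrnAr -mulrnDl; congr (_ *+ _).
  rewrite subSn -1?ltnS // exprS !mulrA -mulrDl; congr (_ * _).
  by rewrite [iter i.+1 _ _]/= /ad addrC subrK.
rewrite (eq_bigr _ (fun i _ => step i)) big_split /=.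
(* The terms of index 0 match; the others follow from Pascal's rule, once the vanishing term with
   ['C(n, n.+1)] is added. *)
rewrite [in RHS]big_ord_recl /= bin0 [in X in X + _]big_ord_recl /= bin0.
rewrite -addrA; congr (_ + _).
rewrite [RHS](eq_bigr (fun i : 'I_n.+1 =>
    (iter i.+1 (ad a) b * a ^+ (n.+1 - i.+1)) *+ 'C(n, i.+1)
    + (iter i.+1 (ad a) b * a ^+ (n.+1 - i.+1)) *+ 'C(n, i))); last first.
  by move=> i _; rewrite -mulrnDr binS.
rewrite big_split /=; congr (_ + _).
by rewrite [RHS]big_ord_recr /= bin_small // mulr0n addr0.
Qed.

(** In the binomial expansion only the indices 0 and p survive, as p divides the binomial
    coefficients in between. *)
Lemma commutator_expr_pchar (a b : A) :
  a ^+ p * b - b * a ^+ p = iter p (ad a) b.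
Proof.
have p_prime := pcharf_prime charFp.
rewrite expr_mul_ad big_ord_recr /= subnn mulr1 binn.
rewrite -(prednK (prime_gt0 p_prime)) big_ord_recl /= bin0 subn0 big1.
  by rewrite !mulr1n addr0 addrAC subrr add0r.
move=> i _; rewrite prednK ?prime_gt0 //.
have /dvdnP[k ->] : (p %| 'C(p, bump 0 i))%N.
  rewrite prime_dvd_bin // /bump /= add1n.
  by rewrite -[ltnRHS](prednK (prime_gt0 p_prime)) ltnS ltn_ord.
by rewrite mulrnA -scaler_nat pcharf0 // scale0r.
Qed.

End Commutators.

(** * Prescribing a linear map on one further vector *)

Section LinearExtension.
Variables (F : fieldType) (G : vectType F) (A : lmodType F).

Lemma dim_add_line (M : {vspace G}) w :
  w \notin M -> \dim (M + <[w]>) = (\dim M).+1.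
Proof.
move=> wM; have w0 : w != 0 by apply: contraNneq wM => ->; apply: mem0v.
rewrite dimv_disjoint_sum ?dim_vline ?w0 ?addn1 //.
apply/eqP; rewrite -subv0; apply/subvP => x; rewrite memv_cap memv0.
case/andP=> xM /vlineP[c xE]; have [c0|c0] := eqVneq c 0.
  by rewrite xE c0 scale0r.
by case/negP: wM; rewrite -(scalerK c0 w) -xE memvZ.
Qed.

Lemma linear_extension (M : {vspace G}) (f : {linear G -> A}) w a :
  w \notin M ->
  exists f' : {linear G -> A}, {in M, f' =1 f} /\ f' w = a.
Proof.
move=> wM; have w0 : w != 0 by apply: contraNneq wM => ->; apply: mem0v.
have MwI : (M :&: <[w]> = 0)%VS.
  apply/eqP; rewrite -dimv_eq0; have := dimv_sum_cap M <[w]>.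
  by rewrite dim_add_line // dim_vline w0 addn1 -[RHS]addn0 => /addnI ->.
have MwI' : (<[w]> :&: M = 0)%VS by rewrite capvC.
pose X := [tuple w]; pose pi x := daddv_pi <[w]> M x.
(* A linear form on [G] that vanishes on [M] and takes the value 1 at [w]. *)
pose c x : F := coord X ord0 (pi x).
have Xfree : free X by rewrite /free span_seq1 dim_vline w0.
have cM x : x \in M -> c x = 0.
  move=> xM; rewrite /c /pi.
  suff -> : daddv_pi <[w]> M x = 0 by rewrite linear0.
  have := daddv_pi_add MwI' (subvP (addvSr _ _) _ xM).
  rewrite (daddv_pi_id MwI xM) => /(canRL (addrK x)) ->.
  by rewrite subrr.
have cw : c w = 1.
  rewrite /c /pi daddv_pi_id ?memv_line //.
  by rewrite -[X in coord _ _ X]/(X`_(ord0 : 'I_1)) coord_free // eqxx.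
pose f0 x := f (x - c x *: w) + c x *: a.
have f0_lin : linear f0.
  move=> k x y; rewrite /f0.
  have -> : c (k *: x + y) = k * c x + c y by rewrite /c /pi !linearP.
  rewrite [in RHS]scalerDr addrACA scalerA -scalerDl.
  rewrite -[in RHS]linearP; congr (f _ + _).
  by rewrite scalerDl scalerBr scalerA opprD addrACA.
pose l0 := GRing.isLinear.Build F G A *:%R f0 f0_lin.
pose f' : {linear G -> A} := HB.pack f0 l0.
exists f'; split=> [x xM|]; rewrite /= /f0.
  by rewrite cM // !scale0r subr0 addr0.
by rewrite cw !scale1r subrr linear0 add0r.
Qed.

End LinearExtension.

(** * Induction and centrality in enveloping algebras *)

Lemma uea_ind (F : fieldType) (L : lieType F) (P : uea L -> Prop) :
  P 0 -> P 1 -> (forall c a b, P a -> P b -> P (c *: a + b)) ->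
  (forall x a, P a -> P (uea_in x * a)) -> forall a, P a.
Proof.
move=> P0 P1 Plin Pmul a; have [u ->] := quot_pi_surj a.
pose pi : {lrmorphism free_alg F L -> uea L} := quot_pi (uea_ideal L).
rewrite -[quot_pi _ u]/(pi u) [u]free_algE linear_sum.
apply: big_rec => [//|m b _ Pb]; rewrite linearZ; apply: Plin => //.
rewrite rmorph_prod; apply: big_rec => [//|x c _ Pc]; exact: Pmul.
Qed.

Lemma uea_commr (F : fieldType) (L : lieType F) (z : uea L) :
  (forall x, GRing.comm (uea_in x) z) -> forall a, GRing.comm a z.
Proof.
move=> z_comm; elim/uea_ind => [||c a b az bz|x a az].
- by rewrite /GRing.comm mul0r mulr0.
- exact/commr_sym/commr1.
- by rewrite /GRing.comm mulrDl mulrDr -scalerAl -scalerAr az bz.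
- exact/commr_sym/commrM/commr_sym/az/commr_sym/z_comm.
Qed.

(** * Antisymmetry and transporters in a Lie algebra *)

Section LieTheory.
Variables (F : fieldType) (L : lieType F).

HB.instance Definition _ (z : L) := GRing.isLinear.Build F L L *:%R (lie z)
  (fun a x y => lie_linearr a x y z).

Lemma lieDl (x y z : L) : lie (x + y) z = lie x z + lie y z.
Proof. by have := lie_linearl 1 x y z; rewrite !scale1r. Qed.

Lemma lieC (x y : L) : lie x y = - lie y x.
Proof.
have := liexx (x + y); rewrite lieDl !raddfD /= !liexx add0r addr0.
by move/(canRL (addrK _)); rewrite sub0r.
Qed.

(** The elements that bracket [U] into [V]; testing on a basis of [U] presents them as a finite
    intersection of subspaces. *)
Definition transporter (U V : {vspace L}) : {vspace L} :=
  (\bigcap_(i < \dim U) linfun (lie (vbasis U)`_i) @^-1: V)%VS.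

Lemma transporterP (U V : {vspace L}) h :
  reflect {in U, forall x, lie x h \in V} (h \in transporter U V).
Proof.
apply: (iffP idP) => [|hUV].
  rewrite memvE => /subv_bigcapP hUV x xU; rewrite lieC memvN.
  rewrite (coord_vbasis xU) linear_sum memv_suml // => i _.
  rewrite linearZ memvZ //= lieC memvN; have := hUV i isT.
  by rewrite -memvE -memv_preim lfunE.
rewrite memvE; apply/subv_bigcapP => i _; rewrite -memvE -memv_preim lfunE /=.
by apply/hUV/vbasis_mem/mem_nth; rewrite size_tuple.
Qed.

End LieTheory.

(** * Brackets and flags in a p-envelope *)

Section PEnvelope.
Variables (F : fieldType) (p : nat) (charFp : p \in [pchar F]).
Variables (L G : lieType F) (ppow : G -> G) (ppowP : is_p_mapping p ppow).
Variables (iota : 'Hom(L, G)) (iota_lie : is_lie_hom iota).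
Variables (iota_inj : injective iota).
Variables (Lp : lieSubalg G) (LpP : is_p_envelope ppow iota Lp).

Local Notation E := (limg iota).
Local Notation H := (lsub_vspace Lp).
Local Notation q := (\dim H - \dim E)%N.
Local Notation inH := (fun x : G => uea_in (vsproj H x)).

Lemma lie_limg : {in E &, forall x y, lie x y \in E}.
Proof.
move=> _ _ /memv_imgP[x _ ->] /memv_imgP[y _ ->].
by rewrite -iota_lie memv_img ?memvf.
Qed.

(* By Jacobi and [ad (x^[p]) = (ad x)^p], the transporter is a p-closed
   subalgebra, so minimality of the envelope applies; it is used first with
   U = E, then with U = H. *)
Lemma p_envelope_transporter (U : {vspace G}) : (E <= U)%VS ->
  {in U & E, forall x y, lie x y \in E} ->
  {in U & H, forall x y, lie x y \in E}.
Proof.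
move=> EU UE; pose N := transporter U E.
have Nlie x y : x \in U -> y \in N -> lie y x \in E.
  by move=> xU /transporterP/(_ x xU); rewrite lieC memvN.
have NE x y : x \in E -> y \in N -> lie y x \in E.
  by move=> xE; apply/Nlie/(subvP EU).
have N_closed x y : x \in N -> y \in N -> lie x y \in N.
  move=> xN yN; apply/transporterP => z zU.
  have := lie_jacobi z x y; rewrite -addrA => /(canRL (addrK _)).
  rewrite sub0r => ->; rewrite memvN memvD // NE //; first exact: Nlie.
  by rewrite lieC memvN Nlie.
pose N' := LieSubalg N_closed.
suff HN : (H <= N')%VS by move=> x y xU /(subvP HN)/transporterP; apply.
apply: (p_envelope_min LpP) => [x xN|]; last first.
  by apply/subvP => y yE; apply/transporterP => x xU; apply: UE.
apply/transporterP => z zU; rewrite lieC memvN (p_mapping_ad ppowP).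
rewrite -(prednK (prime_gt0 (pcharf_prime charFp))) iterSr.
have : lie x z \in E by apply: Nlie.
by elim: p.-1 (lie x z) => //= n IHn v vE; apply/NE/xN/IHn.
Qed.

(** The case U = E yields [E, H] inside E, which is the hypothesis for the case U = H. *)
Lemma p_envelope_bracket : {in H &, forall x y, lie x y \in E}.
Proof.
have EH := p_envelope_sub LpP.
apply: (p_envelope_transporter EH) => x y xH yE; rewrite lieC memvN.
exact: (p_envelope_transporter (subvv E) lie_limg).
Qed.

(** Any such [M] is a subalgebra, as its brackets fall into [E]. Were it also p-closed, minimality
    would force M = H. *)
Lemma p_envelope_between (M : {vspace G}) : (E <= M)%VS -> (M <= H)%VS ->
  M != H -> exists2 y, y \in M & ppow y \notin M.
Proof.
move=> EM MH; rewrite eqEsubv MH /= => /negP nHM.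
apply: contrapT => noy; apply: nHM.
have M_closed x y : x \in M -> y \in M -> lie x y \in M.
  by move=> xM yM; apply/(subvP EM)/p_envelope_bracket; apply/(subvP MH).
pose M' := LieSubalg M_closed; suff : (H <= M')%VS by [].
apply: (p_envelope_min LpP) => // x xM.
by apply/negPn/negP => wM; apply: noy; exists x.
Qed.

Lemma p_envelope_flag : exists (y : nat -> G) (M : nat -> {vspace G}),
  [/\ M 0%N = E, forall k, M k.+1 = (M k + <[ppow (y k)]>)%VS, M q = H,
      forall k, (k <= q)%N -> (E <= M k)%VS /\ (M k <= H)%VS &
      forall k, (k < q)%N -> y k \in M k /\ ppow (y k) \notin M k].
Proof.
have /choice[Y YP] (M : {vspace G}) : exists y, (E <= M)%VS -> (M <= H)%VS ->
    M != H -> y \in M /\ ppow y \notin M.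
  have [/and3P[EM MH nMH]|nM] := boolP [&& (E <= M)%VS, (M <= H)%VS & M != H].
    by have [y yM wM] := p_envelope_between EM MH nMH; exists y.
  (* A default value, so that [Y] is defined on all subspaces. *)
  by exists 0 => EM MH nMH; rewrite EM MH nMH in nM.
pose M k := iter k (fun V => (V + <[ppow (Y V)]>)%VS) E.
have EH := p_envelope_sub LpP; have dEH := dimvS EH.
have flagP k : (k <= q)%N ->
    [/\ (E <= M k)%VS, (M k <= H)%VS & \dim (M k) = (\dim E + k)%N].
  elim: k => [|k IHk] kq; first by rewrite /= addn0.
  have [EM MH dM] := IHk (ltnW kq).
  have nMH : M k != H.
    by apply: contraTneq kq => MH'; rewrite -leqNgt -MH' dM addKn.
  have [yM wM] := YP _ EM MH nMH; split.
  - exact/(subv_trans EM)/addvSl.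
  - rewrite subv_add MH -memvE; exact/(p_envelope_closed LpP)/(subvP MH).
  - by rewrite dim_add_line // dM addnS.
exists (Y \o M), M; split=> // [|k kq|k kq].
(* Each step adds one dimension, so after [q] steps the dimension of [H] is reached; the subtraction
   in [q] does not truncate, since E lies in H. *)
- have [_ MH dM] := flagP q (leqnn _).
  by apply/eqP; rewrite -(dimv_leqif_eq MH) dM subnKC.
- by have [] := flagP k kq.
- have [EM MH dM] := flagP k (ltnW kq); apply: YP => //.
  by apply: contraTneq kq => MH'; rewrite -leqNgt -MH' dM addKn.
Qed.

(** * Extending homomorphisms along the flag *)

Section UniversalProperty.
Variables (A : algType F).

(** Maps stay total on [G] and are constrained only on [M], so climbing the flag involves no change
    of domain. *)
Definition lie_hom_on (M : {vspace G}) (f : G -> A) :=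
  {in M &, forall x y, f (lie x y) = f x * f y - f y * f x}.

(** Both sides are p-fold iterated commutators with [y], and the iterates stay in [M]. Thus
    [f y ^+ p] acts as the image of [ppow y] should, even when [ppow y] lies outside [M]. *)
Lemma lie_hom_ppow (M : {vspace G}) (f : G -> A) y x :
  (E <= M)%VS -> (M <= H)%VS -> lie_hom_on M f -> y \in M -> x \in M ->
  f (lie (ppow y) x) = f y ^+ p * f x - f x * f y ^+ p.
Proof.
move=> EM MH fM yM xM.
rewrite (commutator_expr_pchar charFp) (p_mapping_ad ppowP).
suff [] : iter p (lie y) x \in M /\
    f (iter p (lie y) x) = iter p (fun b => f y * b - b * f y) (f x) by [].
elim: p => [|n [IHM IHf]] //=; split; last by rewrite fM // IHf.
by apply/(subvP EM)/p_envelope_bracket; apply/(subvP MH).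
Qed.

(** The image of [ppow y] must have the same commutators with f(M) as [f y ^+ p], so it may be
    shifted by any [a] commuting with f(M). *)
Lemma lie_hom_extend (M : {vspace G}) (f : {linear G -> A}) y a :
  (E <= M)%VS -> (M <= H)%VS -> lie_hom_on M f ->
  y \in M -> ppow y \notin M -> {in M, forall x, GRing.comm (f x) a} ->
  exists f' : {linear G -> A}, [/\ {in M, f' =1 f},
    f' (ppow y) = f y ^+ p + a & lie_hom_on (M + <[ppow y]>) f'].
Proof.
move=> EM MH fM yM wM fa; set w := ppow y.
have [f' [f'M f'w]] := linear_extension f (f y ^+ p + a) wM.
exists f'; split=> //.
have lieM x z : x \in M -> z \in M -> lie x z \in M.
  by move=> xM zM; apply/(subvP EM)/p_envelope_bracket; apply/(subvP MH).
have wx x : x \in M -> f' (lie w x) = f' w * f' x - f' x * f' w.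
  move=> xM; rewrite f'w (f'M x xM) mulrDl mulrDr -(fa x xM) opprD addrACA.
  rewrite subrr addr0 -(lie_hom_ppow EM MH fM yM xM) f'M //.
  apply/(subvP EM)/p_envelope_bracket; last exact: (subvP MH).
  exact/(p_envelope_closed LpP)/(subvP MH).
pose P x z := f' (lie x z) = f' x * f' z - f' z * f' x.
have Psym x z : P x z -> P z x.
  by rewrite /P lieC raddfN /= => /(canRL (@opprK _)) ->; rewrite opprB.
have Plin x z1 z2 c : P x z1 -> P x z2 -> P x (z1 + c *: z2).
  rewrite /P !linearD !linearZ /= => -> ->.
  by rewrite mulrDr mulrDl -scalerAr -scalerAl opprD addrACA -scalerBr.
move=> x z /memv_addP[x1 x1M [_ /vlineP[c1 ->] ->]].
move=> /memv_addP[x2 x2M [_ /vlineP[c2 ->] ->]]; rewrite -/(P _ _).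
have Pww : P w w by rewrite /P liexx subrr raddf0.
have P12 : P x1 x2 by rewrite /P !f'M ?lieM ?fM.
(* Bilinearity reduces the claim to pairs from [M] and [w]. *)
apply: (Plin); apply: (Psym); apply: (Plin) => //.
- exact: (Psym).
- exact/(Psym)/wx.
- exact: wx.
Qed.

Lemma uea_p_envelope_universal (y : nat -> G) (M : nat -> {vspace G})
    (g : {lrmorphism uea L -> A}) (u : nat -> A) :
  M 0%N = E -> (forall k, M k.+1 = (M k + <[ppow (y k)]>)%VS) -> M q = H ->
  (forall k, (k <= q)%N -> (E <= M k)%VS /\ (M k <= H)%VS) ->
  (forall k, (k < q)%N -> y k \in M k /\ ppow (y k) \notin M k) ->
  (forall i b, GRing.comm b (u i)) ->
  exists phi : {lrmorphism uea (subvs_of Lp) -> A},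
    (forall x, phi (inH (iota x)) = g (uea_in x)) /\
    (forall k, (k < q)%N ->
       phi (inH (ppow (y k))) = phi (inH (y k)) ^+ p + u k).
Proof.
move=> M0 MS Mq MH My u_comm.
have f_step k : (k <= q)%N -> exists f : {linear G -> A},
    [/\ forall x, f (iota x) = g (uea_in x), lie_hom_on (M k) f &
        forall i, (i < k)%N -> f (ppow (y i)) = f (y i) ^+ p + u i].
  elim: k => [_|k IHk kq].
    have kiota : lker iota == 0%VS by apply/lker0P.
    (* On [E] the map is forced: go back to [L], then apply [g]. *)
    exists (g \o (@uea_in F L \o (iota^-1)%VF)); split=> // [x|].
      by rewrite /= lker0_lfunK.
    rewrite M0 => _ _ /memv_imgP[x _ ->] /memv_imgP[z _ ->].
    by rewrite -iota_lie /= !lker0_lfunK // uea_in_lie rmorphB !rmorphM.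
  have [f [f_iota f_lie fy]] := IHk (ltnW kq).
  have [EM MkH] := MH k (ltnW kq); have [yM wM] := My k kq.
  have [f' [f'M f'w f'_lie]] :=
    lie_hom_extend EM MkH f_lie yM wM (fun x _ => u_comm k (f x)).
  have Mmono i : (i <= k)%N -> (M i <= M k)%VS.
    by move/subnK <-; elim: (k - i)%N => //= n IHn; rewrite addSn MS
      (subv_trans IHn) ?addvSl.
  exists f'; split=> [x||i].
  - by rewrite f'M // (subvP EM) // memv_img ?memvf.
  - by rewrite MS.
  (* Earlier relations persist, since [y i] and [ppow (y i)] already lie in [M k], where [f'] agrees
     with [f]. *)
  rewrite ltnS leq_eqVlt => /predU1P[->|ik]; first by rewrite f'w f'M.
  have [yiM _] := My i (ltn_trans ik kq).
  have yik : y i \in M k := subvP (Mmono i (ltnW ik)) _ yiM.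
  have wik : ppow (y i) \in M k.
    apply: (subvP (Mmono i.+1 ik)); rewrite MS.
    by rewrite (subvP (addvSr _ _)) ?memv_line.
  by rewrite !f'M ?fy.
have [f [f_iota f_lie fy]] := f_step q (leqnn q); rewrite Mq in f_lie.
pose fH : {linear subvs_of Lp -> A} := f \o vsval.
have fH_lie x z : fH (lie x z) = fH x * fH z - fH z * fH x.
  by apply: f_lie; apply: subvsP.
have [phi phiE] := uea_universal fH_lie.
have phi_in x : x \in H -> phi (inH x) = f x.
  by move=> xH; rewrite phiE /= vsprojK.
exists phi; split=> [x|k kq].
  by rewrite phi_in ?f_iota // (subvP (p_envelope_sub LpP)) ?memv_img ?memvf.
have [yM _] := My k kq; have yH := subvP (MH k (ltnW kq)).2 _ yM.
by rewrite !phi_in ?fy //; apply: (p_envelope_closed LpP).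
Qed.

End UniversalProperty.

(** * The isomorphism and its consequence for skewfields *)

Lemma uea_p_envelope_isom :
  exists (phi : {lrmorphism uea (subvs_of Lp) -> central_poly (uea L) q})
         (psi : {lrmorphism central_poly (uea L) q -> uea (subvs_of Lp)}),
    cancel phi psi /\ cancel psi phi.
Proof.
have [y [M [M0 MS Mq MH My]]] := p_envelope_flag.
have inH_lie : {in H &, forall x z,
    inH (lie x z) = inH x * inH z - inH z * inH x}.
  move=> x z xH zH; rewrite -uea_in_lie; congr (uea_in _).
  by apply: val_inj; rewrite /= !vsprojK // lsub_closed.
have iotaH x : iota x \in H.
  by rewrite (subvP (p_envelope_sub LpP)) ?memv_img ?memvf.
pose e : {linear L -> uea (subvs_of Lp)} := @uea_in F _ \o (vsproj H \o iota).
have e_lie x z : e (lie x z) = e x * e z - e z * e x.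
  by rewrite /e /= iota_lie inH_lie.
have [e' e'E] := uea_universal e_lie.
pose z k := inH (ppow (y k)) - inH (y k) ^+ p.
have z_comm k : (k < q)%N -> forall b, GRing.comm b (z k).
  move=> kq; apply: uea_commr => x; apply: commr_sym.
  have yH : y k \in H := subvP (MH k (ltnW kq)).2 _ (My k kq).1.
  have wH := p_envelope_closed LpP yH.
  have EH := p_envelope_sub LpP.
  (* The bracket of [ppow (y k)] with [x] is computed twice, as a commutator with its image and as
     one with the p-th power of the image of [y k]. *)
  have := inH_lie _ _ wH (subvsP x).
  rewrite (lie_hom_ppow (A := uea _) EH (subvv H) inH_lie yH (subvsP x)).
  rewrite vsvalK => /esym/eqP; rewrite subr_eq => /eqP wx.
  rewrite /GRing.comm mulrBl mulrBr wx.
  by rewrite addrAC [X in X - _ + _]addrC addrK addrC.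
(* The flag is indexed by all naturals; beyond [q] the central element is set to 0. *)
pose u i := if insub i is Some j then cpolyX (uea L) (j : 'I_q) else 0.
have u_comm i b : GRing.comm b (u i).
  rewrite /u; case: insub => [j|]; first exact: commr_cpolyX.
  by rewrite /GRing.comm mulr0 mul0r.
have [phi [phi_iota phi_w]] := uea_p_envelope_universal (cpolyC q (A := uea L))
  M0 MS Mq MH My u_comm.
have [psi [psiC psiX]] := cpoly_universal e' (fun i => z_comm _ (ltn_ord i)).
exists phi, psi; split=> a; last first.
  apply: (cpoly_ext (g := phi \o psi) (h := idfun)) => {a} [a|i] /=.
    rewrite psiC.
    apply: (uea_ext (g := phi \o e') (h := cpolyC q (A := uea L))) => x /=.
    by rewrite e'E phi_iota.
  rewrite psiX rmorphB rmorphXn /= phi_w ?ltn_ord // addrAC subrr add0r.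
  by rewrite /u valK.
pose t : {linear G -> uea (subvs_of Lp)} := @uea_in F _ \o vsproj H.
pose d : {linear G -> uea (subvs_of Lp)} := psi \o (phi \o t).
(* Climbing the flag, psi after phi fixes the images of [M k]: at [ppow (y k)] the p-th power
   subtracted by [psi] is the one added by [phi]. *)
have dt k : (k <= q)%N -> {in M k, d =1 t}.
  elim: k => [|k IHk] kq x.
    by rewrite M0 => /memv_imgP[v _ ->]; rewrite /d /= phi_iota psiC e'E.
  have dw : d (ppow (y k)) = t (ppow (y k)).
    have dy := IHk (ltnW kq) (y k) (My k kq).1.
    rewrite /d /= phi_w // rmorphD rmorphXn /=.
    rewrite -[psi (phi _)]/(d (y k)) dy.
    by rewrite /u insubT psiX addrC subrK.
  rewrite MS => /memv_addP[x1 x1M [_ /vlineP[c ->] ->]].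
  by rewrite [x1 + _]addrC (linearP d) (linearP t) dw IHk // ltnW.
apply: (uea_ext (g := psi \o phi) (h := idfun)) => x /=.
have := dt q (leqnn q) (vsval x); rewrite Mq /d /t /= vsvalK.
by apply; apply: subvsP.
Qed.

End PEnvelope.

Theorem proposition2p1p4 (F : closedFieldType) (p : nat)
    (charFp : p \in [pchar F])
    (L G : lieType F) (ppow : G -> G) (ppowP : is_p_mapping p ppow)
    (iota : 'Hom(L, G)) (iota_lie : is_lie_hom iota) (iota_inj : injective iota)
    (Lp : lieSubalg G) (LpP : is_p_envelope ppow iota Lp) :
  let q := (\dim Lp - \dim (limg iota))%N in
  alg_isom (uea (subvs_of Lp)) (central_poly (uea L) q)
  /\
  (forall (KLp : unitAlgType F) (jLp : {lrmorphism uea (subvs_of Lp) -> KLp})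
          (KL : unitAlgType F) (jL : {lrmorphism uea L -> KL}),
     is_frac_skewfield jLp -> is_frac_skewfield jL ->
     exists Q : unitAlgType F,
       is_rational_function_ring KL q Q /\ alg_isom KLp Q).
Proof.
move=> q; have [phi [psi [phiK psiK]]] :=
  uea_p_envelope_isom charFp ppowP iota_lie iota_inj LpP.
split=> [|KLp jLp KL jL jLpP jLP]; first by exists phi; exists psi.
(* [KLp] is itself a ring of rational functions over [KL], so the isomorphism is the identity. *)
exists KLp; split; last by exists idfun; exists idfun.
exact: (rational_functions_of_isom (Bijective psiK phiK) jLpP jLP).
Qed.
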